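(* Let $d_0>0$, $D>0$, let $N\ge 1$ be an integer, and put $M=\lfloor D/d_0\rfloor$. For any $N$-element array with positions $p_1,\dots,p_N\in[0,D]$ (whether or not the positions are integer multiples of $d_0$), the coarray DOF satisfies $$\mathrm{DOF}(\{p_n\})\;\le\;\min\bigl(N^2-N+1,\;2M+1\bigr).$$
   Context: Here $d_0=\lambda/2$ is the half-wavelength (Nyquist) spacing, where $\lambda>0$ is the wavelength. For positions $p_1,\dots,p_N$ the difference coarray is $\mathbb{D}=\{p_i-p_j:1\le i,j\le N\}$. The coarray DOF is $$\mathrm{DOF}(\{p_n\})=\max\{2M_c+1 : M_c\in\mathbb{Z}_{\ge 0},\ \{-M_cd_0,-(M_c-1)d_0,\dots,(M_c-1)d_0,M_cd_0\}\subseteq\mathbb{D}\}.$$ *)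

(* Defs.v *)
From HB Require Import structures.
From mathcomp Require Import all_boot all_order all_algebra.
From mathcomp Require Import boolp classical_sets reals.

Set Implicit Arguments.
Unset Strict Implicit.
Unset Printing Implicit Defensive.

Import Order.TTheory GRing.Theory Num.Theory.

Local Open Scope classical_set_scope.
Local Open Scope ring_scope.

Definition coarray (R : realType) (N : nat) (p : 'I_N -> R) : set R :=
  [set p i - p j | i in [set: 'I_N] & j in [set: 'I_N]].

Definition centered_ula (R : realType) (d0 : R) (Mc : nat) : set R :=
  [set k%:~R * d0 | k in [set k : int | - Mc%:Z <= k <= Mc%:Z]].

Definition dof_values (R : realType) (d0 : R) (N : nat) (p : 'I_N -> R) :
    set nat :=
  [set (2 * Mc + 1)%N | Mc in [set Mc | centered_ula d0 Mc `<=` coarray p]].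

Definition is_max (A : set nat) (m : nat) : Prop :=
  A m /\ forall a, A a -> (a <= m)%N.

(* The default value 0 is only taken when there is no maximum; by [DOF_max]
   below this does not happen when d0 > 0 and the array is nonempty. *)
Definition DOF (R : realType) (d0 : R) (N : nat) (p : 'I_N -> R) : nat :=
  xget 0%N [set m | is_max (dof_values d0 p) m].

Lemma DOF_max (R : realType) (d0 : R) (N : nat) (p : 'I_N -> R) :
  0 < d0 -> (1 <= N)%N -> is_max (dof_values d0 p) (DOF d0 p).
Proof.
move=> d0_gt0 N_gt0.
pose B : R := \sum_i \sum_j `|p i - p j|.
pose P n := `[< dof_values d0 p n >].
have exP : exists n, P n.
  exists 1%N; apply/asboolP; exists 0%N => // _ [k /= k0 <-].
  have -> : k = 0 by apply/eqP; rewrite eq_le andbC; rewrite oppr0 in k0.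
  exists (Ordinal N_gt0) => //; exists (Ordinal N_gt0) => //.
  by rewrite subrr mul0r.
have ubP n : P n -> (n <= 2 * Num.truncn (B / d0) + 1)%N.
  move=> /asboolP[Mc /= sub <-].
  rewrite leq_add2r leq_mul2l /= truncn_ge_nat; last first.
    apply: divr_ge0 (ltW d0_gt0).
    by apply: sumr_ge0 => i _; apply: sumr_ge0 => j _.
  rewrite ler_pdivlMr //.
  have /sub[i _ [j _ pij]] : centered_ula d0 Mc (Mc%:R * d0).
    by exists Mc%:Z => //=; rewrite lexx andbT lerNl (le_trans _ (le0z_nat _)) // oppr_le0.
  rewrite -pij (le_trans (ler_norm _)) // /B (bigD1 i) //= (bigD1 j) //=.
  rewrite -addrA lerDl addr_ge0 //; first exact: sumr_ge0.
  by apply: sumr_ge0 => i' _; apply: sumr_ge0.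
have [m /asboolP Am maxm] := ex_maxnP exP ubP.
apply: (@xgetPex _ 0%N [set m | is_max (dof_values d0 p) m]).
by exists m; split => // a Aa; apply/maxm/asboolP.
Qed.

(* Main.v *)
(** The DOF is attained: it equals 2 Mc + 1 for some Mc such that each k d0 with
    |k| <= Mc is a difference of two positions. The 2 Mc nonzero multiples come
    from distinct ordered pairs of distinct sensors, of which there are N^2 - N,
    so 2 Mc <= N^2 - N; and Mc d0, a difference of two points of [0, D], is at
    most D. *)
Require Import Defs.
From HB Require Import structures.
From mathcomp Require Import all_boot all_order all_algebra.
From mathcomp Require Import boolp classical_sets reals.
From mathcomp Require Import zify.

Import Order.TTheory GRing.Theory Num.Theory.

Local Open Scope ring_scope.

Lemma card_offdiag (T : finType) :
  #|[set x : T * T | x.1 != x.2]| = (#|T| ^ 2 - #|T|)%N.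
Proof.
have diagE : [set x : T * T | x.1 != x.2] = ~: [set (i, i) | i in [set: T]]%SET.
  apply/setP => -[i j]; rewrite !inE /=; congr (~~ _).
  by apply/eqP/imsetP => [->|[k _ [-> ->]]] //; exists j.
by rewrite diagE cardsCs finset.setCK card_imset ?cardsT ?card_prod // => i j [].
Qed.

Lemma centered_ula_card (R : realType) (d0 : R) (N Mc : nat) (p : 'I_N -> R) :
  0 < d0 -> (centered_ula d0 Mc `<=` coarray p)%classic ->
  (2 * Mc <= N ^ 2 - N)%N.
Proof.
move=> d0_gt0 sub.
(* The shift by [Mc] turns the indices 0, ..., 2 Mc into the lags -Mc, ..., Mc; index [Mc] is the
   zero lag. *)
pose v (k : 'I_(2 * Mc).+1) : int := k%:Z - Mc%:Z.
have vP k : exists x : 'I_N * 'I_N, p x.1 - p x.2 = (v k)%:~R * d0.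
  have /sub[i _ [j _ pij]] : centered_ula d0 Mc ((v k)%:~R * d0).
    by exists (v k) => //=; have := ltn_ord k; rewrite /v; lia.
  by exists (i, j).
have [f fE] := choice vP.
have v_inj : injective (fun k => (v k)%:~R * d0).
  move=> k l /(mulIf (lt0r_neq0 d0_gt0)) /intr_inj; rewrite /v => kl.
  by apply: val_inj; move: kl => /=; lia.
(* The pair [f k] determines its difference, hence the lag and [k]. *)
have f_inj : injective f by move=> k l kl; apply: v_inj; rewrite -!fE kl.
have Mc_lt : (Mc < (2 * Mc).+1)%N by lia.
(* The zero lag is dropped: a diagonal pair has difference 0, so [f] sends all other indices off the
   diagonal. *)
have -> : (2 * Mc)%N = #|f @: [set~ Ordinal Mc_lt]%SET|.
  by rewrite card_imset // cardsC1 card_ord.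
have <- : #|[set x : 'I_N * 'I_N | x.1 != x.2]| = (N ^ 2 - N)%N.
  by rewrite card_offdiag card_ord.
apply/subset_leq_card/fintype.subsetP => _ /imsetP[k + ->].
rewrite !inE; apply: contra_neq => fk.
by apply: v_inj; rewrite -fE fk subrr /v /= subrr mul0r.
Qed.

Lemma centered_ula_aperture (R : realType) (d0 D : R) (N Mc : nat)
    (p : 'I_N -> R) :
  0 < d0 -> (forall n, 0 <= p n <= D) ->
  (centered_ula d0 Mc `<=` coarray p)%classic -> Mc%:Z <= Num.floor (D / d0).
Proof.
move=> d0_gt0 p_in sub.
have /sub[i _ [j _ pij]] : centered_ula d0 Mc (Mc%:Z%:~R * d0).
  by exists Mc%:Z => //=; lia.
rewrite floor_ge_int ler_pdivlMr // -pij.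
have /andP[_ pi_le] := p_in i; have /andP[pj_ge _] := p_in j.
by rewrite lerBlDr (le_trans pi_le) // lerDl.
Qed.

Theorem theorem1 (R : realType) (d0 D : R) (N : nat) (p : 'I_N -> R)
    (d0_gt0 : 0 < d0) (D_gt0 : 0 < D) (N_ge1 : (1 <= N)%N)
    (p_in : forall n : 'I_N, 0 <= p n <= D) :
  let M : int := Num.floor (D / d0) in
  (DOF d0 p)%:Z <= Num.min (N%:Z ^+ 2 - N%:Z + 1) (2 * M + 1).
Proof.
have [[Mc sub <-] _] := DOF_max p d0_gt0 N_ge1.
have := centered_ula_card _ _ _ _ _ d0_gt0 sub.
have := centered_ula_aperture _ _ _ _ _ _ d0_gt0 p_in sub.
rewrite /= le_min !expr2 -mulnn => leM leN.
(* Ensures that the truncated subtraction in [leN] agrees with the integer one in the goal. *)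
have N_leNN : (N <= N * N)%N by rewrite leq_pmulr.
by apply/andP; split; lia.
Qed.
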